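(* Let $\mathcal{W}(J)$ be an $S\mathcal{W}$-subgroup of $\mathcal{W}$, let $\mathcal{W}(J')$ be a good dual of $\mathcal{W}(J)$, and let $U$ be a $K\mathcal{W}$-submodule of $M^{\Delta}$. Then either $S^{J,J'}\subseteq U$ or $U\subseteq (S^{J,J'})^{\perp}$, where $(S^{J,J'})^{\perp}$ is the orthogonal complement of $S^{J,J'}$ in $M^{\Delta}$ with respect to the bilinear form $\langle\,,\rangle$.
   Context: $\Phi$ is a root system (finite, reduced, crystallographic) in a finite-dimensional real Euclidean space, with simple system $\pi$ and Weyl group $\mathcal{W}=\mathcal{W}(\Phi)$; $l$ is the length function with respect to $\pi$ and $s(w)=(-1)^{l(w)}$. $K$ is an arbitrary field. Steinberg subgroups. Let $\Theta$ be a root system with simple system $\pi_\Theta$ and let $\rho$ be a symmetry of its Dynkin diagram, induced by an isometry $\tau$ of the ambient space such that $\tau(r)$ is a positive multiple of $\rho(r)$ for each $r\in\pi_\Theta$ (in types $B_2,F_4,G_2$ the symmetry may interchange long and short roots). Then $\mathcal{W}(\Theta)^1=\{w\in\mathcal{W}(\Theta):\tau w\tau^{-1}=w\}$ is the Steinberg subgroup; it acts faithfully, as a group generated by reflections, on the fixed space $V^1$ of $\tau$, and it is generated by the elements $w_0^{O}$, for $O$ running over the $\rho$-orbits in $\pi_\Theta$, where $w_0^{O}$ is the longest element of the subgroup generated by the reflections in the roots of $O$. Its roots are the projections of the roots of $\Theta$ to $V^1$ (one chosen from each class of positive multiples), and its simple roots are the projections of $\pi_\Theta$. Extended subsystems and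 $S\mathcal{W}$-subgroups. An extended subsystem $\Psi$ of $\Phi$, with simple system $J$ and Dynkin diagram $\Delta$, is a root system obtained (up to the action of $\mathcal{W}$) by the following algorithm: (i) form the extended Dynkin diagram of $\Phi$, by adding to the diagram a node corresponding to the negative of the highest root; (ii) delete one or more nodes in all possible ways; (iii) take a symmetry $\rho$ (possibly the identity) of the remaining Dynkin diagram and form the corresponding Steinberg subgroup with its root system; (iv) take also the duals of the diagrams obtained in the same way from the dual root system of $\Phi$ (long and short roots interchanged); (v) repeat the process with the diagrams obtained, any number of times (extending each connected component and deleting at least one node from each extended component). The subgroup $\mathcal{W}(J)$ of $\mathcal{W}$ generated by the reflections $\tau_\alpha$, $\alpha\in\Psi$ (for Steinberg subgroups: by the elements of $\mathcal{W}$ in the Steinberg subgroup which act as these reflections on $V^1$) is called a Steinberg–Weyl ($S\mathcal{W}$-) subgroup of $\mathcal{W}$. For $w\in\mathcal W$, $\mathcal{W}(wJ)=w\mathcal{W}(J)w^{-1}$. Tabloids and modules. Let $\mathcal{W}(J)$ be an $S\mathcal{W}$-subgroup. The $\Delta$-tabloids are the left cosets $\{w\mathcal{W}(J)\}$, $w\in\mathcal{W}$; $\mathcal{W}$ acts on them by left multiplication. $M^\Delta$ is the $K$-space with basis the $\Delta$-tabloids, a $K\mathcal{W}$-module. A useful dual of $\mathcal{W}(J)$ is an $S\mathcal{W}$-subgroup $\mathcal{W}(J')$ of $\mathcal{W}$ with $\mathcal{W}(J)\cap\mathcal{W}(J')=\langle e\rangle$. Put $\kappa_{J'}=\sum_{\sigma\in\mathcal{W}(J')}s(\sigma)\sigma$,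 $e_{J,J'}=\kappa_{J'}\{\mathcal{W}(J)\}$ and, for $w\in\mathcal{W}$, $e_{wJ,wJ'}=w\,e_{J,J'}=\kappa_{wJ'}\{w\mathcal{W}(J)\}$. $S^{J,J'}$ is the $K$-span in $M^\Delta$ of all $e_{wJ,wJ'}$, $w\in\mathcal{W}$. A useful dual $\mathcal{W}(J')$ is a good dual of $\mathcal{W}(J)$ if for every $w\in\mathcal{W}$ with $\kappa_{J'}\{w\mathcal{W}(J)\}\neq 0$, the tabloid $\{w\mathcal{W}(J)\}$ appears (with non-zero coefficient) in $e_{J,J'}$. Form: $\langle\,,\rangle$ is the bilinear form on $M^\Delta$ with $\langle\{w_1\mathcal{W}(J)\},\{w_2\mathcal{W}(J)\}\rangle=1$ if $w_1\mathcal{W}(J)=w_2\mathcal{W}(J)$ and $0$ otherwise. *)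

(* Defs.v *)
From HB Require Import structures.
From mathcomp Require Import all_boot all_order all_algebra.
From mathcomp Require Import all_classical all_reals.

Set Implicit Arguments.
Unset Strict Implicit.
Unset Printing Implicit Defensive.

Import Order.TTheory GRing.Theory Num.Theory.
Local Open Scope classical_set_scope.
Local Open Scope ring_scope.

(* The Euclidean space is the space 'cV[R]_n of column vectors with its
   standard inner product; the Weyl group consists of matrices, acting on the
   left, so that the product u *m v is the composite "v first, then u". *)

Section EuclideanReflections.
Variables (R : realType) (n : nat).
Implicit Types (a b r u v : 'cV[R]_n) (A J C V : set 'cV[R]_n).

Definition dot u v : R := (u^T *m v) 0 0.

Definition refl a : 'M[R]_n := 1%:M - (2 / dot a a) *: (a *m a^T).

Definition cartan a b : R := 2 * dot a b / dot b b.

Definition coroot a : 'cV[R]_n := (2 / dot a a) *: a.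

Definition cone J v : Prop :=
  exists2 c : 'cV[R]_n -> R, (forall r, 0 <= c r) &
    v = \sum_(r \in J) c r *: r.

Definition natcone J v : Prop :=
  exists c : 'cV[R]_n -> nat, v = \sum_(r \in J) r *+ c r.

Record root_system (Phi : set 'cV[R]_n) : Prop := RootSystem {
  root_finite : finite_set Phi;
  root_neq0 : ~ Phi 0;
  root_refl : forall a b, Phi a -> Phi b -> Phi (refl a *m b);
  root_reduced : forall a (c : R), Phi a -> Phi (c *: a) -> c = 1 \/ c = -1;
  root_crystallographic : forall a b, Phi a -> Phi b ->
    cartan a b \is a Num.int }.

Record simple_system (Phi pi : set 'cV[R]_n) : Prop := SimpleSystem {
  simple_sub : pi `<=` Phi;
  simple_free : exists2 s : seq 'cV[R]_n, free s & pi = [set` s];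
  simple_sign : forall b, Phi b -> cone pi b \/ cone pi (- b) }.

Record subgroup (G : set 'M[R]_n) : Prop := Subgroup {
  subgroup_unit : forall w, G w -> w \in unitmx;
  subgroup1 : G 1%:M;
  subgroupM : forall w1 w2, G w1 -> G w2 -> G (w1 *m w2);
  subgroupV : forall w, G w -> G (invmx w) }.

Definition generated (X : set 'M[R]_n) : set 'M[R]_n := smallest subgroup X.

Definition weyl A : set 'M[R]_n := generated (refl @` A).

Definition lcoset (w : 'M[R]_n) (X : set 'M[R]_n) : set 'M[R]_n :=
  mulmx w @` X.

Definition conjugate (w : 'M[R]_n) (X : set 'M[R]_n) : set 'M[R]_n :=
  [set w *m h *m invmx w | h in X].

Definition has_word (pi : set 'cV[R]_n) (w : 'M[R]_n) : set nat :=
  [set k | exists s : seq 'cV[R]_n,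
     [/\ size s = k, [set` s] `<=` pi
       & w = \big[mulmx/1%:M]_(r <- s) refl r]].

(* The value is 0 if w has no word at all; this does not happen on the Weyl
   group. *)
Definition len (pi : set 'cV[R]_n) (w : 'M[R]_n) : nat :=
  xget 0%N [set k | has_word pi w k /\ forall j, has_word pi w j -> (k <= j)%N].

End EuclideanReflections.

Section DynkinDiagrams.
Variables (R : realType) (n : nat).
Implicit Types (a b r : 'cV[R]_n) (J C D : set 'cV[R]_n).

(* For distinct nodes a and b of a Dynkin diagram, bond a b is the number of edges
   joining them. *)
Definition bond a b : R := cartan a b * cartan b a.

Definition separated C J : Prop :=
  forall a b, C a -> J b -> ~ C b -> dot a b = 0.

Definition component J C : Prop :=
  [/\ C `<=` J, C !=set0, separated C J
    & forall D, D `<=` C -> D !=set0 -> separated D C -> D = C].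

(* The root system with simple system J. *)
Definition root_closure J : set 'cV[R]_n :=
  [set x | exists w b, [/\ weyl J w, J b & x = w *m b]].

(* C is meant to be a component of a diagram.  Coefficients are natural
   numbers, so a component has a highest root only if its root system is
   crystallographic; dihedral diagrams of order 16, which arise from F4, are
   therefore never extended. *)
Definition highest_root C h : Prop :=
  root_closure C h /\ forall b, root_closure C b -> natcone C (h - b).

Definition extended_diagram J : set 'cV[R]_n :=
  J `|` [set a | exists C h, [/\ component J C, highest_root C h & a = - h]].

(* J1 is what remains of the extended diagram of J after deleting at least one
   node from each extended component. *)
Definition deletion J J1 : Prop :=
  J1 `<=` extended_diagram J /\
  forall C h, component J C -> highest_root C h -> ~ (C `|` [set - h] `<=` J1).

Definition type_B2_or_G2 C : Prop :=
  exists a b, C = [set a; b] /\ (bond a b = 2 \/ bond a b = 3).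

Definition type_F4 C : Prop :=
  exists a b c d, [/\ C = [set a; b; c; d],
    bond a b = 1, bond b c = 2 & bond c d = 1] /\
    [/\ bond a c = 0, bond a d = 0 & bond b d = 0].

(* Equality of Cartan integers says that both the bonds and the arrows are
   preserved; arrows may be reversed on components of type B2, F4, G2. *)
Definition diagram_symmetry J (rho : 'cV[R]_n -> 'cV[R]_n) : Prop :=
  [/\ set_bij J J rho,
      forall r s, J r -> J s -> bond (rho r) (rho s) = bond r s
    & forall C r s, component J C -> C r -> C s ->
        ~ (type_B2_or_G2 C \/ type_F4 C) ->
        cartan (rho r) (rho s) = cartan r s].

End DynkinDiagrams.

Section SteinbergWeyl.
Variables (R : realType) (n : nat).
Local Notation vec := 'cV[R]_n.
Local Notation mx := 'M[R]_n.

(* A root system reached by the algorithm: it lives in the subspace space, with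
   simple system simple, and group is a group of matrices which acts on space as
   the Weyl group of roots does.  The elements of group need not act trivially
   on the orthogonal complement of space. *)
Record stage := Stage {
  space : set vec;
  roots : set vec;
  simple : set vec;
  group : set mx }.

Definition initial (Phi pi : set vec) : stage := Stage setT Phi pi (weyl Phi).

Definition dual (X : stage) : stage :=
  Stage (space X) (@coroot R n @` roots X) (@coroot R n @` simple X) (group X).

Definition acts_as_reflection (V : set vec) (h : mx) (a : vec) : Prop :=
  forall v, V v -> h *m v = refl a *m v.

Definition extend_delete (X Y : stage) : Prop :=
  [/\ deletion (simple X) (simple Y),
      space Y = space X,
      roots Y = root_closure (simple Y)
    & group Y = generated [set h | group X h /\
        exists2 a, roots Y a & acts_as_reflection (space Y) h a]].

Definition isometry_on (V : set vec) (tau : mx) : Prop :=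
  (forall v, V v -> V (tau *m v)) /\
  (forall u v, V u -> V v -> dot (tau *m u) (tau *m v) = dot u v).

Definition projections (V A : set vec) : set vec :=
  [set p | V p /\ exists2 a, A a & forall u, V u -> dot (a - p) u = 0].

Definition pos_multiple (p q : vec) : Prop := exists2 c : R, 0 < c & p = c *: q.

Definition steinberg_root_system (X Y : stage) : Prop :=
  [/\ roots Y `<=` projections (space Y) (roots X),
      forall p, projections (space Y) (roots X) p ->
        exists! q, roots Y q /\ pos_multiple p q,
      forall a b, roots Y a -> roots Y b -> roots Y (refl a *m b),
      simple Y = roots Y `&` projections (space Y) (simple X)
    & forall p, projections (space Y) (simple X) p ->
        exists2 q, simple Y q & pos_multiple p q].

Definition steinberg_subgroup (X : stage) (tau : mx) : set mx :=
  [set h | group X h /\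
     forall v, space X v -> h *m (tau *m v) = tau *m (h *m v)].

Definition steinberg (X Y : stage) : Prop :=
  exists rho tau,
    [/\ diagram_symmetry (simple X) rho,
        isometry_on (space X) tau
      & forall r, simple X r -> pos_multiple (tau *m r) (rho r)] /\
    [/\ space Y = [set v | space X v /\ tau *m v = v],
        steinberg_root_system X Y
      & group Y = generated [set h | steinberg_subgroup X tau h /\
          exists2 a, roots Y a & acts_as_reflection (space Y) h a]].

Definition step (X Y : stage) : Prop :=
  exists2 Z, extend_delete X Z & steinberg Z Y.

Definition dual_step (X Y : stage) : Prop :=
  exists2 Z, step (dual X) Z & Y = dual Z.

Inductive reachable (X : stage) : stage -> Prop :=
| reachable_first Y : step X Y \/ dual_step X Y -> reachable X Y
| reachable_next Y Z :
    reachable X Y -> step Y Z \/ dual_step Y Z -> reachable X Z.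

Definition SW_subgroup (Phi pi : set vec) (H : set mx) : Prop :=
  exists w X, [/\ weyl Phi w, reachable (initial Phi pi) X
                & H = conjugate w (group X)].

End SteinbergWeyl.

Section TabloidModule.
Variables (R : realType) (n : nat) (K : fieldType).
Local Notation mx := 'M[R]_n.
(* Functions from sets of matrices to K; those vanishing outside the (finite)
   set of tabloids form the K-space with basis the tabloids. *)
Local Notation func := (set mx -> K^o).
Variables (Phi pi : set 'cV[R]_n) (H H' : set mx).

Definition tabloids : set (set mx) := [set lcoset w H | w in weyl Phi].

Definition tabloid_module : set func :=
  [set f | forall X, ~ tabloids X -> f X = 0].

Definition tabloid_vec (X : set mx) : func := fun Y => (`[< Y = X >])%:R.

Definition act (w : mx) (f : func) : func := fun X => f (lcoset (invmx w) X).

Definition sgn (w : mx) : K := (-1) ^+ len pi w.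

Definition kappa (f : func) : func := \sum_(w \in H') sgn w *: act w f.

Definition polytabloid : func := kappa (tabloid_vec H).

Definition linear_span (A : set func) : set func :=
  [set f | exists s : seq (K * func),
     (forall p, p \in s -> A p.2) /\ f = \sum_(p <- s) p.1 *: p.2].

Definition specht : set func :=
  linear_span [set act w polytabloid | w in weyl Phi].

Definition form (f g : func) : K := \sum_(X \in tabloids) f X * g X.

Definition orthogonal_complement (S : set func) : set func :=
  [set f | tabloid_module f /\ forall g, S g -> form f g = 0].

Record submodule (U : set func) : Prop := Submodule {
  submodule_sub : U `<=` tabloid_module;
  submodule0 : U 0;
  submoduleD : forall f g, U f -> U g -> U (f + g);
  submoduleZ : forall (c : K) f, U f -> U (c *: f);
  submodule_act : forall w f, weyl Phi w -> U f -> U (act w f) }.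

Definition useful_dual : Prop :=
  SW_subgroup Phi pi H' /\ H `&` H' = [set 1%:M].

Definition good_dual : Prop :=
  useful_dual /\
  forall w, weyl Phi w -> kappa (tabloid_vec (lcoset w H)) <> 0 ->
    polytabloid (lcoset w H) <> 0.

End TabloidModule.

(* Main.v *)
(* Write kappa for the signed sum over H'.  The sign is multiplicative on the
   Weyl group, since the simple reflections generate the group and have
   determinant -1.  Hence, for sigma in H', kappa sends the tabloid sigma H to a
   multiple of the polytabloid e, and goodness of the dual says that kappa kills
   every other tabloid; so kappa u is always a multiple of e.  If kappa u is
   nonzero for some u in U, then e lies in U, and so does the Specht module.
   Otherwise kappa kills U, and <u, w e> = <kappa (w^-1 u), H> = 0 because kappa
   is self-adjoint. *)
Require Import Defs.
From mathcomp Require Import all_boot all_order all_algebra.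
From mathcomp Require Import all_classical all_reals.
From mathcomp Require Import lra.

Set Implicit Arguments.
Unset Strict Implicit.
Unset Printing Implicit Defensive.

Import Order.TTheory GRing.Theory Num.Theory.
Local Open Scope classical_set_scope.
Local Open Scope ring_scope.

(** * Reflections as matrices, and products of reflections *)

Section Reflections.
Variables (R : realType) (n : nat).
Implicit Types (a b r u v : 'cV[R]_n) (w : 'M[R]_n) (l : seq 'cV[R]_n).

Lemma dotE u v : dot u v = \sum_i u i 0 * v i 0.
Proof. by rewrite /dot mxE; apply: eq_bigr => i _; rewrite mxE. Qed.

Lemma dotC u v : dot u v = dot v u.
Proof. by rewrite !dotE; apply: eq_bigr => i _; rewrite mulrC. Qed.

Lemma dotBr u v1 v2 : dot u (v1 - v2) = dot u v1 - dot u v2.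
Proof. by rewrite /dot mulmxBr mxE [X in _ + X]mxE. Qed.

Lemma dotZr u (c : R) v : dot u (c *: v) = c * dot u v.
Proof. by rewrite /dot -scalemxAr mxE. Qed.

Lemma dot_sumr u (I : Type) (s : seq I) (F : I -> 'cV[R]_n) :
  dot u (\sum_(i <- s) F i) = \sum_(i <- s) dot u (F i).
Proof. by rewrite /dot mulmx_sumr summxE. Qed.

Lemma dot_ge0 u : 0 <= dot u u.
Proof. by rewrite dotE sumr_ge0// => i _; rewrite -expr2 sqr_ge0. Qed.

Lemma dot_eq0 u : dot u u = 0 -> u = 0.
Proof.
rewrite dotE => /eqP; rewrite psumr_eq0 => [/allP u0|i _]; last first.
  by rewrite -expr2 sqr_ge0.
apply/colP => i; rewrite mxE; apply/eqP.
by have := u0 i (mem_index_enum i); rewrite /= mulf_eq0 orbb.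
Qed.

Lemma dot_gt0 u : u <> 0 -> 0 < dot u u.
Proof. by move=> u0; rewrite lt_neqAle dot_ge0 andbT eq_sym; apply/eqP => /dot_eq0. Qed.

Lemma refl_mulE a v : refl a *m v = v - (2 / dot a a * dot a v) *: a.
Proof.
rewrite /refl mulmxBl mul1mx -scalemxAl -mulmxA [a^T *m v]mx11_scalar.
by rewrite mul_mx_scalar scalerA.
Qed.

Lemma refl_self a : a <> 0 -> refl a *m a = - a.
Proof.
move=> /dot_gt0 a0; rewrite refl_mulE divfK ?gt_eqF// scaler_nat mulr2n.
by rewrite opprD addrA subrr sub0r.
Qed.

Lemma refl_tr a : (refl a)^T = refl a.
Proof. by rewrite /refl linearB linearZ /= trmx1 trmx_mul trmxK. Qed.

Lemma reflK a : a <> 0 -> refl a *m refl a = 1%:M.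
Proof.
move=> a0; rewrite {2}/refl mulmxBr mulmx1 -scalemxAr mulmxA refl_self//.
by rewrite mulNmx scalerN opprK /refl addrNK.
Qed.

(** The rank-one case of the matrix determinant lemma: one bordered matrix is factored into block
    triangular matrices in two ways, and the two determinants are compared. *)
Lemma det_1Bmul (u v : 'cV[R]_n) : \det (1%:M - u *m v^T) = 1 - dot v u.
Proof.
have E : block_mx (1%:M : 'M[R]_1) v^T u 1%:M
       = block_mx 1%:M 0 u 1%:M *m block_mx 1%:M v^T 0 (1%:M - u *m v^T).
  by rewrite mulmx_block !(mulmx1, mul1mx, mul0mx, mulmx0, addr0, add0r) addrC subrK.
have F : block_mx (1%:M : 'M[R]_1) v^T u 1%:M
       = block_mx (1%:M - v^T *m u) v^T 0 1%:M *m block_mx 1%:M 0 u 1%:M.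
  by rewrite mulmx_block !(mulmx1, mul1mx, mul0mx, mulmx0, addr0, add0r) subrK.
move: (congr1 determinant E); rewrite F !det_mulmx !(det_ublock, det_lblock) !det1.
by rewrite !(mul1r, mulr1) det_mx11 => <-; rewrite mxE; congr (_ + _); rewrite mxE.
Qed.

Lemma det_refl a : a <> 0 -> \det (refl a) = -1.
Proof.
move=> /dot_gt0 a0; rewrite /refl scalemxAl det_1Bmul dotZr.
by rewrite divfK ?gt_eqF//; lra.
Qed.

Lemma refl_conj w a : w^T *m w = 1%:M ->
  refl (w *m a) = w *m refl a *m w^T.
Proof.
move=> wK; have wK' : w *m w^T = 1%:M by exact: mulmx1C.
rewrite /refl {1 2}/dot !trmx_mul mulmxA -(mulmxA a^T) wK mulmx1 -/(dot a a).
by rewrite mulmxBr mulmxBl mulmx1 wK' -scalemxAr -scalemxAl !mulmxA.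
Qed.

Definition wprod l : 'M[R]_n := \big[mulmx/1%:M]_(r <- l) refl r.

Lemma wprod_cons r l : wprod (r :: l) = refl r *m wprod l.
Proof. by rewrite /wprod big_cons. Qed.

Lemma wprod_cat l1 l2 : wprod (l1 ++ l2) = wprod l1 *m wprod l2.
Proof.
elim: l1 => [|r l1 IH]; first by rewrite /wprod big_nil mul1mx.
by rewrite cat_cons !wprod_cons IH mulmxA.
Qed.

Lemma wprod1 r : wprod [:: r] = refl r.
Proof. by rewrite wprod_cons /wprod big_nil mulmx1. Qed.

Lemma wprod_tr l : (wprod l)^T = wprod (rev l).
Proof.
elim: l => [|r l IH]; first by rewrite /wprod !big_nil trmx1.
by rewrite wprod_cons trmx_mul IH refl_tr rev_cons -cats1 wprod_cat wprod1.
Qed.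

Section Words.
Variable A : set 'cV[R]_n.
Hypothesis A0 : ~ A 0.

Let A_neq0 r : A r -> r <> 0. Proof. by move=> Ar r0; rewrite r0 in Ar. Qed.

Lemma wprod_revK l : [set` l] `<=` A -> wprod (rev l) *m wprod l = 1%:M.
Proof.
elim: l => [|r l IH] lA; first by rewrite /wprod !big_nil mulmx1.
rewrite rev_cons -cats1 wprod_cat wprod1 wprod_cons mulmxA -(mulmxA _ (refl r) (refl r)).
rewrite reflK ?mulmx1 ?IH// => [x xl|]; first by apply: lA; rewrite /= in_cons xl orbT.
by apply: A_neq0; apply: lA; rewrite /= mem_head.
Qed.

Lemma wprod_orthogonal l : [set` l] `<=` A -> (wprod l)^T *m wprod l = 1%:M.
Proof. by rewrite wprod_tr; exact: wprod_revK. Qed.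

Lemma wprod_unit l : [set` l] `<=` A -> wprod l \in unitmx.
Proof. by move=> /wprod_revK/mulmx1_unit[]. Qed.

Lemma invmx_wprod l : [set` l] `<=` A -> invmx (wprod l) = wprod (rev l).
Proof.
move=> lA; apply: (can_inj (mulKmx (wprod_unit lA))).
by rewrite mulmxV ?wprod_unit//; symmetry; apply/mulmx1C/wprod_revK.
Qed.

Lemma det_wprod l : [set` l] `<=` A -> \det (wprod l) = (-1) ^+ size l.
Proof.
elim: l => [|r l IH] lA; first by rewrite /wprod big_nil det1.
rewrite wprod_cons det_mulmx IH => [|x xl]; last by apply: lA; rewrite /= in_cons xl orbT.
by rewrite det_refl ?exprS//; apply: A_neq0; apply: lA; rewrite /= mem_head.
Qed.

(** Concatenation gives products and reversal gives inverses, reflections being involutions. Since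
    [weyl A] is the smallest subgroup containing the reflections, every element of it is therefore a
    word. *)
Lemma subgroup_wprod : subgroup [set wprod l | l in [set l : seq 'cV[R]_n | [set` l] `<=` A]].
Proof.
split=> [_ [l lA <-]||_ _ [l1 A1 <-] [l2 A2 <-]|_ [l lA <-]].
- exact: wprod_unit.
- by exists [::] => //; rewrite /wprod big_nil.
- exists (l1 ++ l2); last exact: wprod_cat.
  by move=> x; rewrite /= mem_cat => /orP[/A1|/A2].
- exists (rev l); last by rewrite invmx_wprod.
  by move=> x; rewrite /= mem_rev => /lA.
Qed.

Lemma weyl_word w : weyl A w -> exists2 l, [set` l] `<=` A & w = wprod l.
Proof.
move=> /(_ [set wprod l | l in [set l : seq 'cV[R]_n | [set` l] `<=` A]])[].
  split; first exact: subgroup_wprod.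
  move=> _ [a Aa <-]; exists [:: a]; last exact: wprod1.
  by move=> x /=; rewrite inE => /eqP->.
by move=> l lA <-; exists l.
Qed.

End Words.

(** If no subgroup contained [X], the intersection defining [generated X] would be the set of all
    matrices. Invertibility of the generators supplies one such subgroup, the group of units. *)
Lemma generated_subgroup (X : set 'M[R]_n) :
  (forall w, X w -> w \in unitmx) -> subgroup (generated X).
Proof.
move=> Xu.
have US : subgroup [set w : 'M[R]_n | w \in unitmx].
  split=> //= [|w1 w2 u1 u2|w]; [exact: unitmx1|by rewrite unitmx_mul u1|].
  by rewrite unitmx_inv.
split=> [w /(_ _ (conj US Xu))//|G [[]]//|w1 w2 h1 h2 G GX|w h G GX].
  by case: (GX) => -[_ _ GM _] _; apply: GM; [exact: h1|exact: h2].
by case: (GX) => -[_ _ _ GV] _; apply: GV; exact: h.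
Qed.

End Reflections.

(** The element [x] is counted by [a2] on top of everything counted by [a1]. This yields the strict
    decrease in the induction on heights of roots. *)
Lemma count_lt (T : eqType) (t : seq T) (a1 a2 : pred T) x :
  subpred a1 a2 -> x \in t -> a2 x -> ~~ a1 x -> (count a1 t < count a2 t)%N.
Proof.
move=> a12 xt a2x a1x.
have x0 : (0 < count_mem x t)%N by rewrite -has_count has_pred1.
apply: leq_trans (_ : count (predU a1 (pred1 x)) t <= _)%N; last first.
  by apply: sub_count => y /= /orP[/a12|/eqP->].
rewrite -[X in (_ <= X)%N]addn0 -(count_pred0 t).
rewrite -(@eq_count _ (predI a1 (pred1 x)) pred0) => [|y /=]; last first.
  by apply/negP => /andP[+ /eqP yx]; rewrite yx (negbTE a1x).
by rewrite count_predUI -addn1 leq_add2l.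
Qed.

(** * The Weyl group: finiteness, generation by simple reflections, and the sign as a determinant *)

Section SimpleReflections.
Variables (R : realType) (n : nat) (Phi pi : set 'cV[R]_n).
Hypotheses (rootPhi : root_system Phi) (simple_pi : simple_system Phi pi).

Let Phi0 := root_neq0 rootPhi.

Let Phi_neq0 a : Phi a -> a <> 0.
Proof. by move=> Pa a0; apply: Phi0; rewrite -a0. Qed.

Lemma pi_neq0 : ~ pi 0.
Proof. by move=> /(simple_sub simple_pi)/Phi0. Qed.

Lemma root_opp a : Phi a -> Phi (- a).
Proof. by move=> Pa; rewrite -refl_self; [exact: root_refl|exact: Phi_neq0]. Qed.

Lemma subgroup_weyl : subgroup (weyl Phi).
Proof.
apply: generated_subgroup => _ [a Pa <-].
by have /mulmx1_unit[] := reflK (Phi_neq0 Pa).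
Qed.

Lemma weyl_orthogonal w : weyl Phi w -> w^T *m w = 1%:M.
Proof. by move=> /(weyl_word Phi0)[l lP ->]; exact: wprod_orthogonal lP. Qed.

Lemma weyl_root w b : weyl Phi w -> Phi b -> Phi (w *m b).
Proof.
move=> /(weyl_word Phi0)[l lP ->]; elim: l lP => [|r l IH] lP Pb.
  by rewrite /wprod big_nil mul1mx.
rewrite wprod_cons -mulmxA; apply: root_refl => //.
  by apply: lP; rewrite /= mem_head.
by apply: IH => // x xl; apply: lP; rewrite /= in_cons xl orbT.
Qed.

Lemma weyl_sub_fixed w v :
  weyl Phi w -> (forall b, Phi b -> dot b v = 0) -> w *m v = v.
Proof.
move=> /(weyl_word Phi0)[l lP ->] v0; elim: l lP => [|r l IH] lP.
  by rewrite /wprod big_nil mul1mx.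
rewrite wprod_cons -mulmxA IH => [|x xl]; last by apply: lP; rewrite /= in_cons xl orbT.
by rewrite refl_mulE v0 ?mulr0 ?scale0r ?subr0//; apply: lP; rewrite /= mem_head.
Qed.

(* [w v - v] is orthogonal to itself: it is orthogonal to every root, hence is
   fixed by [w], which is an isometry. *)
Lemma weyl_eq1 w : weyl Phi w -> (forall b, Phi b -> w *m b = b) -> w = 1%:M.
Proof.
move=> Ww wb; have wK := weyl_orthogonal Ww.
have dotw x y : dot (w *m x) (w *m y) = dot x y.
  by rewrite /dot trmx_mul mulmxA -(mulmxA x^T) wK mulmx1.
suff wv (v : 'cV[R]_n) : w *m v = v.
  apply/matrixP => i j; have := wv (delta_mx j 0).
  by rewrite -colE -(mul1mx (delta_mx j 0)) -colE => /colP/(_ i); rewrite !mxE.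
set d := w *m v - v.
have d0 b : Phi b -> dot b d = 0.
  by move=> Pb; rewrite /d dotBr -{1}(wb b Pb) dotw subrr.
have wd := weyl_sub_fixed Ww d0.
suff /dot_eq0/eqP : dot d d = 0 by rewrite /d subr_eq0 => /eqP.
by rewrite {2}/d dotBr -{1}wd dotw subrr.
Qed.

(** By [weyl_eq1] an element is determined by its action on the finite set of roots, so the group
    embeds into a finite type of functions. *)
Lemma finite_weyl : finite_set (weyl Phi).
Proof.
have [s Ps] := (finite_seqP _).1 (root_finite rootPhi).
(* The roots are numbered by their positions in [s]. The extra value leaves room for [size s], which
   [index] returns outside the list, and [inord] needs a successor type. *)
pose f (w : 'M[R]_n) : {ffun 'I_(size s) -> 'I_(size s).+1} :=
  [ffun i : 'I_(size s) => inord (index (w *m s`_i) s)].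
suff finj : {in weyl Phi &, injective f}.
  (* Sending every matrix outside the group to [None] makes the group a preimage under a total map,
     so that injectivity on the group suffices. *)
  pose g w := if w \in weyl Phi then Some (f w) else None.
  have -> : weyl Phi = g @^-1` [set~ None].
    by apply/seteqP; split=> w; rewrite /= /g; [move=> /mem_set->|case: ifPn => [/set_mem|]].
  apply: finite_preimage => // w1 w2; rewrite !inE /= /g.
  by case: ifPn => // W1 _; case: ifPn => // W2 _ [/finj]; exact.
move=> w1 w2 /set_mem W1 /set_mem W2 E.
have W1V := subgroupV subgroup_weyl W1; have U1 := subgroup_unit subgroup_weyl W1.
suff E1 : invmx w1 *m w2 = 1%:M by rewrite -[w2](mulKVmx U1) E1 mulmx1.
apply: weyl_eq1 => [|b Pb]; first exact: (subgroupM subgroup_weyl).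
suff Eb : w1 *m b = w2 *m b by rewrite -mulmxA -Eb mulKmx.
have st x : Phi x -> x \in s by rewrite Ps.
have := congr1 (fun h : {ffun _ -> _} => val (h (Ordinal (etrans (index_mem b s) (st _ Pb))))) E.
rewrite !ffunE /= nth_index ?st// !inordK ?ltnS ?index_size//.
move=> /(congr1 (nth 0 s)); rewrite !nth_index ?st//; exact: weyl_root.
Qed.

Lemma coefs_inj (s : seq 'cV[R]_n) (c d : 'cV[R]_n -> R) : free s ->
  \sum_(r <- s) c r *: r = \sum_(r <- s) d r *: r -> {in s, c =1 d}.
Proof.
move=> fs E x xs.
have cE e : coord (in_tuple s) (Ordinal (etrans (index_mem x s) xs))
              (\sum_(r <- s) e r *: r) = e x.
  rewrite (big_nth 0) big_mkord (coord_sum_free (fun i : 'I__ => e s`_i))//=.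
  by rewrite nth_index.
by rewrite -(cE c) E cE.
Qed.

(* Induction on the number of roots of smaller height: a positive root [v] that
   is not simple has a positive product with some simple root [r] of its
   support, and [refl r] sends it to a positive root of smaller height. *)
Lemma root_simple_orbit b : Phi b ->
  exists l r, [/\ [set` l] `<=` pi, pi r & b = wprod l *m r].
Proof.
have [s fs piE] := simple_free simple_pi.
have [t Pt] := (finite_seqP _).1 (root_finite rootPhi).
have us := free_uniq fs.
have spi x : x \in s -> pi x by rewrite piE.
have coneE v : cone pi v ->
    exists2 c : 'cV[R]_n -> R, (forall r, 0 <= c r) & v = \sum_(r <- s) c r *: r.
  by move=> [c c0 ->]; exists c => //; rewrite piE -fsbig_seq.
(* The height: the sum of the coordinates in the basis of simple roots. *)
pose ht v := \sum_i coord (in_tuple s) i v.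
have htBZ u (k : R) v : ht (u - k *: v) = ht u - k * ht v.
  rewrite /ht mulr_sumr -sumrB; apply: eq_bigr => i _.
  by rewrite linearB linearZ.
have ht1 r : r \in s -> ht r = 1.
  move=> rs; have rE : r = (in_tuple s)`_(index r s) by rewrite nth_index.
  rewrite /ht {1}rE.
  pose j := Ordinal (etrans (index_mem r s) rs).
  rewrite (bigD1 j)//= (coord_free j)// eqxx big1 ?addr0// => i ij.
  by rewrite (coord_free j)// eq_sym (negbTE ij).
pose below v := count (fun x => ht x < ht v) t.
have pos m : forall v, (below v < m)%N -> Phi v -> cone pi v ->
    exists l r, [/\ [set` l] `<=` pi, pi r & v = wprod l *m r].
  elim: m => [//|m IH] v vm Pv /coneE[c c0 vE].
  (* Expanding one factor of [dot v v] over the simple roots gives a positive sum, so some term is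
     positive. *)
  have [r rs vr] : exists2 r, r \in s & 0 < c r * dot v r.
    apply: contrapT => no; have := dot_gt0 (Phi_neq0 Pv).
    rewrite {2}vE dot_sumr ltNge => /negP; apply; rewrite big_seq.
    apply: sumr_le0 => r rs; rewrite dotZr leNgt; apply/negP => h.
    by apply: no; exists r.
  have dvr : 0 < dot v r.
    by have := c0 r; rewrite le0r => /orP[/eqP c00|/pmulr_rgt0 <-//]; move: vr; rewrite c00 mul0r ltxx.
  have [<-|/eqP nvr] := eqVneq r v.
    by exists [::], r; split; [by []|exact: spi|rewrite /wprod big_nil mul1mx].
  have Pr := simple_sub simple_pi (spi _ rs).
  pose k := 2 / dot r r * dot r v.
  have k0 : 0 < k.
    by rewrite /k (dotC r v) mulr_gt0// divr_gt0//; exact: (dot_gt0 (Phi_neq0 Pr)).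
  have v'E : refl r *m v = v - k *: r by rewrite refl_mulE.
  have Pv' : Phi (refl r *m v) by exact: root_refl.
  have [v'pos|v'neg] := simple_sign simple_pi Pv'.
    have [|l [r' [lp pr' E]]] := IH (refl r *m v) _ Pv' v'pos.
      rewrite ltnS in vm; apply: leq_trans vm; rewrite v'E.
      have htlt : ht (v - k *: r) < ht v by rewrite htBZ (ht1 r)//; lra.
      (* The reflected root itself witnesses the strict decrease: it is lower than [v] but not lower
         than itself. *)
      apply: (count_lt (x := v - k *: r)) => [x /lt_trans||//|]; first exact.
      - by rewrite -v'E -[is_true _]/([set` t] _) -Pt.
      - by rewrite /= ltxx.
    exists (r :: l), r'; split=> //.
      by move=> x; rewrite /= inE => /orP[/eqP->|/lp//]; exact: spi.
    by rewrite wprod_cons -mulmxA -E mulmxA reflK ?mul1mx//; exact: Phi_neq0.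
  (* The reflection changes only the coefficient at [r]. If the result is negative, all other
     coefficients of [v] are both nonnegative and nonpositive, so [v] is a multiple of [r], and
     reducedness forces [v = r]. *)
  have [d d0 dE] := coneE _ v'neg.
  exfalso; apply: nvr.
  have cs x : x \in s -> x != r -> c x = 0.
    move=> xs xr.
    have : \sum_(y <- s) (c y - (y == r)%:R * k) *: y = \sum_(y <- s) (- d y) *: y.
      under [RHS]eq_bigr do rewrite scaleNr.
      rewrite sumrN -dE opprK v'E vE.
      under eq_bigr do rewrite scalerBl.
      rewrite sumrB; congr (_ - _); rewrite (bigD1_seq r)//= eqxx mul1r big1 ?addr0// => y.
      by move=> /negbTE->; rewrite mul0r scale0r.
    move=> /(coefs_inj fs)/(_ x xs); rewrite (negbTE xr) mul0r subr0 => cd.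
    by have := c0 x; have := d0 x; lra.
  have {}vE : v = c r *: r.
    rewrite vE (bigD1_seq r)//= big_seq_cond big1 ?addr0// => y /andP[ys yr].
    by rewrite cs// scale0r.
  have Pcr : Phi (c r *: r) by rewrite -vE.
  have [c1|c1] := root_reduced rootPhi Pr Pcr.
    by rewrite vE c1 scale1r.
  by have := c0 r; rewrite c1 ler0N1.
move=> Pb; have [bp|bn] := simple_sign simple_pi Pb; first exact: (pos _ b (ltnSn _)).
have [l [r [lp pr E]]] := pos _ _ (ltnSn _) (root_opp Pb) bn.
(* Appending [r] to the word replaces [r] by [- r], which absorbs the sign of a negative root. *)
exists (l ++ [:: r]), r; split=> //.
  by move=> x; rewrite /= mem_cat inE => /orP[/lp//|/eqP->].
rewrite wprod_cat wprod1 -mulmxA refl_self ?mulmxN -?E ?opprK//.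
by apply/Phi_neq0/(simple_sub simple_pi).
Qed.

(** Each root is the image of a simple root under a simple word, so its reflection is a conjugate of
    a simple reflection by that word, hence again a simple word. *)
Lemma weyl_simple_word w : weyl Phi w -> exists2 l, [set` l] `<=` pi & w = wprod l.
Proof.
have p0 := pi_neq0.
move=> /(_ [set wprod l | l in [set l : seq 'cV[R]_n | [set` l] `<=` pi]])[].
  split; first exact: subgroup_wprod.
  move=> _ [b Pb <-]; have [l [r [lp pr ->]]] := root_simple_orbit Pb.
  rewrite (refl_conj r (wprod_orthogonal p0 lp)) wprod_tr.
  exists (l ++ r :: rev l); last by rewrite wprod_cat wprod_cons mulmxA.
  by move=> x; rewrite /= mem_cat inE mem_rev => /or3P[/lp//|/eqP->//|/lp].
by move=> l lA <-; exists l.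
Qed.

(** A simple word for [w] exists, so [len] is attained by a shortest word instead of taking its
    default value; each letter contributes a factor [-1]. *)
Lemma det_weyl w : weyl Phi w -> \det w = (-1) ^+ len pi w.
Proof.
move=> /weyl_simple_word[l lp wE].
have [[l' [szl' l'p wl']] _] :
    [set k | has_word pi w k /\ forall j, has_word pi w j -> (k <= j)%N] (len pi w).
  rewrite /len; apply: xgetPex.
  have ex : exists k, `[< has_word pi w k >].
    by exists (size l); apply/asboolP; exists l.
  have [k /asboolP wk kmin] := ex_minnP ex.
  by exists k; split=> // j wj; apply: kmin; apply/asboolP.
by rewrite -szl' wl'; exact: (det_wprod pi_neq0).
Qed.

(** Multiplicativity of the determinant compares parities of lengths over [R], where [1] and [-1]
    differ; the equality of parities then passes to [K], whatever its characteristic. *)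
Lemma sgn_weylM (K : fieldType) w1 w2 : weyl Phi w1 -> weyl Phi w2 ->
  sgn K pi (w1 *m w2) = sgn K pi w1 * sgn K pi w2.
Proof.
move=> W1 W2; have W12 := subgroupM subgroup_weyl W1 W2.
have := det_weyl W12; rewrite det_mulmx !det_weyl// -exprD.
rewrite /sgn -exprD -[LHS]signr_odd -[RHS]signr_odd => h.
rewrite -[LHS]signr_odd -[RHS]signr_odd; congr (_ ^+ nat_of_bool _).
by apply: (@signr_inj R); rewrite /= h.
Qed.

Lemma sgn_neq0 (K : fieldType) w : sgn K pi w != 0.
Proof. by rewrite /sgn signr_eq0. Qed.

End SimpleReflections.

(** * Steinberg-Weyl subgroups as subgroups of the Weyl group *)

Section SteinbergWeylSubgroups.
Variables (R : realType) (n : nat).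

Lemma invmxM (w v : 'M[R]_n) : w \in unitmx -> v \in unitmx ->
  invmx (w *m v) = invmx v *m invmx w.
Proof.
move=> wu vu; have wvu : w *m v \in unitmx by rewrite unitmx_mul wu.
by apply: (can_inj (mulKmx wvu)); rewrite mulmxV// mulmxA mulmxK// mulmxV.
Qed.

Lemma generated_sub (G X : set 'M[R]_n) : subgroup G -> X `<=` G ->
  subgroup (generated X) /\ generated X `<=` G.
Proof.
move=> sG XG; split; last exact: smallest_sub.
by apply: generated_subgroup => w /XG; exact: subgroup_unit.
Qed.

(** Both extension with deletion and the Steinberg construction generate the new group by elements
    of the old one, and dualizing leaves the group unchanged. *)
Lemma reachable_group (X Y : stage R n) : reachable X Y -> subgroup (group X) ->
  subgroup (group Y) /\ group Y `<=` group X.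
Proof.
have stepP (A B : stage R n) : step A B -> subgroup (group A) ->
    subgroup (group B) /\ group B `<=` group A.
  move=> [Z [_ _ _ Zg] [rho [tau [_ [_ _ Bg]]]]] sA.
  have [] := @generated_sub (group A) [set h | group A h /\
        exists2 a, Defs.roots Z a & acts_as_reflection (Defs.space Z) h a] sA.
    by move=> h [].
  rewrite -Zg => sZ ZA.
  have [] := @generated_sub (group Z) [set h | steinberg_subgroup Z tau h /\
          exists2 a, Defs.roots B a & acts_as_reflection (Defs.space B) h a] sZ.
    by move=> h [[]].
  by rewrite -Bg => sB BZ; split=> // h /BZ/ZA.
have dstepP (A B : stage R n) : step A B \/ dual_step A B -> subgroup (group A) ->
    subgroup (group B) /\ group B `<=` group A.
  by case=> [|[Z + ->]]; [exact: stepP|move=> /stepP].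
elim=> [{}Y /dstepP//|{}Y Z _ IH /dstepP YZ sX].
by have [/YZ[sZ ZY] YX] := IH sX; split=> // h /ZY/YX.
Qed.

Lemma subgroup_conjugate (G : set 'M[R]_n) w : w \in unitmx -> subgroup G ->
  subgroup (conjugate w G).
Proof.
move=> wu sG; split=> [_ [h Gh <-]||_ _ [h1 G1 <-] [h2 G2 <-]|_ [h Gh <-]].
- by rewrite !unitmx_mul unitmx_inv wu (subgroup_unit sG Gh).
- by exists 1%:M; [exact: (subgroup1 sG)|rewrite mulmx1 mulmxV].
- by exists (h1 *m h2); [exact: (subgroupM sG)|rewrite !mulmxA mulmxKV].
- have hu := subgroup_unit sG Gh.
  exists (invmx h); first exact: (subgroupV sG).
  by rewrite !invmxM ?unitmx_mul ?unitmx_inv ?wu// invmxK mulmxA.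
Qed.

Lemma SW_subgroup_weyl (Phi pi : set 'cV[R]_n) H : root_system Phi ->
  SW_subgroup Phi pi H -> subgroup H /\ H `<=` weyl Phi.
Proof.
move=> rootPhi [w [X [Ww XP ->]]]; have sW := subgroup_weyl rootPhi.
have [sX XW] := reachable_group XP sW.
split; first exact: (subgroup_conjugate (subgroup_unit sW Ww)).
move=> _ [h /XW Wh <-]; apply: (subgroupM sW); last exact: (subgroupV sW).
exact: (subgroupM sW).
Qed.

End SteinbergWeylSubgroups.

(** * The signed symmetrizer and the bilinear form on the tabloid module *)

Section Tabloids.
Variables (R : realType) (n : nat) (K : fieldType) (Phi pi : set 'cV[R]_n).
Variables (H H' : set 'M[R]_n).
Hypotheses (rootPhi : root_system Phi) (simple_pi : simple_system Phi pi).
Hypotheses (sH' : subgroup H') (H'W : H' `<=` weyl Phi).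
Local Notation func := (set 'M[R]_n -> K^o).
Implicit Types (f g u : func) (w v : 'M[R]_n) (X Y : set 'M[R]_n).

Let sW := subgroup_weyl rootPhi.
Let Wu w (Ww : weyl Phi w) : w \in unitmx := subgroup_unit sW Ww.
Local Notation kappa := (kappa (K := K) pi H').
Local Notation e := (polytabloid K pi H H').
Local Notation sgn := (sgn K pi).

Lemma lcosetM w v X : lcoset w (lcoset v X) = lcoset (w *m v) X.
Proof. by rewrite /lcoset image_comp; apply: eq_imagel => h _ /=; rewrite mulmxA. Qed.

Lemma lcoset1 X : lcoset 1%:M X = X.
Proof. by rewrite /lcoset -[RHS]image_id; apply: eq_imagel => h _; rewrite mul1mx. Qed.

Lemma actM w v f : w \in unitmx -> v \in unitmx -> act w (act v f) = act (w *m v) f.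
Proof.
move=> wu vu; apply/funext => X; rewrite /act lcosetM; congr (f (lcoset _ X)).
by rewrite invmxM.
Qed.

Lemma act_tabloid_vec w X : w \in unitmx ->
  act w (tabloid_vec K X) = tabloid_vec K (lcoset w X).
Proof.
move=> wu; apply/funext => Y; rewrite /act /tabloid_vec; congr (_%:R); congr nat_of_bool.
apply/asboolP/asboolP => [<-|->]; rewrite lcosetM ?mulmxV ?mulVmx// lcoset1//.
Qed.

Lemma finite_H' : finite_set H'.
Proof. exact: sub_finite_set (finite_weyl rootPhi). Qed.

(** A sum over a set is [0] by default when its support is infinite. Finiteness of the Weyl group
    excludes this and gives one list that serves for all [f]. *)
Lemma kappaE : exists s : seq 'M[R]_n, [/\ uniq s, H' = [set` s] &
  forall f, kappa f = \sum_(w <- s) sgn w *: act w f].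
Proof.
exists (finmap.enum_fset (fset_set H')); split=> [||f].
- exact: finmap.fset_uniq.
- by rewrite fset_setK//; exact: finite_H'.
- rewrite /Defs.kappa fsbig_finite//; exact: finite_H'.
Qed.

Lemma kappaD f g : kappa (f + g) = kappa f + kappa g.
Proof.
have [s [_ _ kE]] := kappaE; rewrite !kE -big_split /=; apply: eq_bigr => w _.
by rewrite -scalerDr.
Qed.

Lemma kappaZ (c : K) f : kappa (c *: f) = c *: kappa f.
Proof.
have [s [_ _ kE]] := kappaE; rewrite !kE scaler_sumr; apply: eq_bigr => w _.
by rewrite [RHS]scalerA mulrC -[RHS]scalerA.
Qed.

(** Right translation by [w] permutes [H']; after this reindexing, multiplicativity of the sign lets
    [sgn w] factor out. *)
Lemma kappa_act w f : H' w -> kappa f = sgn w *: kappa (act w f).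
Proof.
move=> Hw; have wu := subgroup_unit sH' Hw.
rewrite /Defs.kappa (reindex_fsbig (mulmx^~ w) H'); last first.
  split=> [v Hv|v1 v2 _ _ E|v Hv]; first exact: (subgroupM sH').
    by rewrite -[v1](mulmxK wu) E mulmxK.
  exists (v *m invmx w); last by rewrite mulmxKV.
  by apply: (subgroupM sH') => //; exact: (subgroupV sH').
rewrite !fsbig_finite; [|exact: finite_H'..].
rewrite scaler_sumr !big_seq; apply: eq_bigr => v.
rewrite in_fset_set ?inE; last exact: finite_H'.
move=> Hv; rewrite (sgn_weylM rootPhi simple_pi) ?actM//; try exact: H'W.
  by rewrite mulrC scalerA.
exact: (subgroup_unit sH' Hv).
Qed.

Lemma sgn_invmx w : weyl Phi w -> sgn (invmx w) = sgn w.
Proof.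
move=> Ww; have W1 := subgroup1 sW.
have s1 : sgn 1%:M = 1.
  apply: (mulfI (sgn_neq0 pi K 1%:M)).
  by rewrite -(sgn_weylM rootPhi simple_pi)// mulmx1 mulr1.
apply: (mulfI (sgn_neq0 pi K w)).
rewrite -(sgn_weylM rootPhi simple_pi)//; last exact: (subgroupV sW).
by rewrite mulmxV ?s1 ?Wu// /Defs.sgn -expr2 sqrr_sign.
Qed.

Lemma finite_tabloids : finite_set (tabloids Phi H).
Proof. exact/finite_image/finite_weyl. Qed.

Lemma form_sumr f (I : Type) (s : seq I) (c : I -> K) (g : I -> func) :
  Defs.form Phi H f (\sum_(i <- s) c i *: g i) = \sum_(i <- s) c i * Defs.form Phi H f (g i).
Proof.
have tE g' := fsbig_finite +%R (fun X => f X * g' X : K) finite_tabloids.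
rewrite /Defs.form tE (eq_bigr _ (fun i _ => congr1 ( *%R (c i)) (tE (g i)))).
under [RHS]eq_bigr do rewrite mulr_sumr.
rewrite exchange_big /=; apply: eq_bigr => X _.
by rewrite fct_sumE mulr_sumr; apply: eq_bigr => i _; rewrite mulrCA.
Qed.

Lemma form_tabloid_vec f X : tabloids Phi H X -> Defs.form Phi H f (tabloid_vec K X) = f X.
Proof.
move=> tX; rewrite /Defs.form (fsbigD1 X)//; last first.
  exact: finite_tabloids.
rewrite {1}/tabloid_vec asboolT//= mulr1 fsbig1 ?addr0// => Y [_ YX].
by rewrite /tabloid_vec asboolF ?mulr0.
Qed.

(** This expansion in the basis of tabloids reduces statements linear in [u] to single tabloids. *)
Lemma tabloid_moduleE u : tabloid_module Phi H u ->
  u = \sum_(X <- finmap.enum_fset (fset_set (tabloids Phi H))) u X *: tabloid_vec K X.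
Proof.
move=> u0; apply/funext => Y; rewrite fct_sumE.
have E : \sum_(X \in tabloids Phi H) u X * tabloid_vec K X Y = u Y.
  have [tY|ntY] := pselect (tabloids Phi H Y).
    rewrite -[RHS](form_tabloid_vec u tY); apply: eq_fsbigr => X _.
    by congr (_ * _%:R); congr nat_of_bool; apply/asboolP/asboolP.
  rewrite (u0 _ ntY) fsbig1// => X tX.
  by rewrite /tabloid_vec asboolF ?mulr0// => YX; apply: ntY; rewrite YX.
by rewrite -E fsbig_finite//; exact: finite_tabloids.
Qed.

(** Self-adjointness of the symmetrizer combined with invariance of the form: both sides are the sum
    over [v] in [H'] of [sgn v * u (lcoset (w *m v) H)]. *)
Lemma form_act_polytabloid u w : weyl Phi w ->
  Defs.form Phi H u (act w e) = kappa (act (invmx w) u) H.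
Proof.
move=> Ww; have wu := Wu Ww.
have [s [us sE kE]] := kappaE.
have sW' v : v \in s -> weyl Phi v by move=> vs; apply: H'W; rewrite sE.
have -> : act w e = \sum_(v <- s) sgn v *: tabloid_vec K (lcoset (w *m v) H).
  rewrite /polytabloid kE /act; apply/funext => X; rewrite !fct_sumE !big_seq.
  apply: eq_bigr => v /sW' Wv.
  rewrite -[X in _ = (_ *: X) _]act_tabloid_vec ?unitmx_mul ?wu ?Wu// -actM ?Wu//.
rewrite form_sumr.
have -> : \sum_(v <- s) sgn v * Defs.form Phi H u (tabloid_vec K (lcoset (w *m v) H)) =
    \sum_(v <- s) sgn v * u (lcoset (w *m v) H).
  rewrite !big_seq; apply: eq_bigr => v /sW' Wv; rewrite form_tabloid_vec//.
  by exists (w *m v) => //; exact: (subgroupM sW).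
(* Since [act v] evaluates a function at a translate by the inverse of [v], the two sums match after
   inverting [v], which preserves the sign. *)
rewrite kE fct_sumE [LHS]fsbig_seq// [RHS]fsbig_seq// -sE [RHS](reindex_fsbig invmx H'); last first.
  split=> [v Hv|v1 v2 _ _ /(can_inj invmxK)//|v Hv]; first exact: (subgroupV sH').
  by exists (invmx v); [exact: (subgroupV sH')|exact: invmxK].
apply: eq_fsbigr => v /set_mem Hv.
rewrite -[RHS]/(sgn (invmx v) *
  u (lcoset (invmx (invmx w)) (lcoset (invmx (invmx v)) H))).
by rewrite sgn_invmx ?invmxK ?lcosetM//; exact: H'W.
Qed.

(* This is where goodness is used: a tabloid not killed by the symmetrizer is
   [sigma H] with [sigma] in [H']. *)
Lemma kappa_line u : good_dual K Phi pi H H' -> tabloid_module Phi H u ->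
  exists c : K, kappa u = c *: e.
Proof.
move=> [_ good] /tabloid_moduleE ->.
rewrite big_seq; apply: (big_ind (fun f => exists c : K, kappa f = c *: e)).
- exists 0; have [s [_ _ kE]] := kappaE.
  by rewrite kE scale0r big1// => w _; rewrite -[act w 0]/(0 : func) scaler0.
- by move=> f g [c fE] [d gE]; exists (c + d); rewrite kappaD fE gE scalerDl.
- move=> X; rewrite in_fset_set ?inE; last exact: finite_tabloids.
  move=> [w Ww <-]; rewrite kappaZ.
  suff [c ->] : exists c : K, kappa (tabloid_vec K (lcoset w H)) = c *: e.
    by exists (u (lcoset w H) * c); rewrite scalerA.
  have [->|/eqP kw0] := eqVneq (kappa (tabloid_vec K (lcoset w H))) 0.
    by exists 0; rewrite scale0r.
  have [s [_ sE kE]] := kappaE.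
  (* The polytabloid is supported on the cosets [lcoset v H] with [v] in [H'], and goodness says
     that its coefficient at [lcoset w H] is nonzero. *)
  have [v Hv vw] : exists2 v, H' v & lcoset w H = lcoset v H.
    apply: contrapT => no; apply: (good _ Ww kw0).
    rewrite /polytabloid kE fct_sumE big_seq big1// => v vs.
    have Hv : H' v by rewrite sE.
    rewrite act_tabloid_vec; last exact: (Wu (H'W Hv)).
    rewrite -[LHS]/(sgn v * _) /tabloid_vec asboolF ?mulr0// => E.
    by apply: no; exists v.
  (* By [kappa_act], the polytabloid is [sgn v] times the symmetrized tabloid of [v], whence the
     inverse sign. *)
  exists (sgn v)^-1; rewrite vw /polytabloid [in RHS](kappa_act _ Hv) act_tabloid_vec; last exact: (Wu (H'W Hv)).
  by rewrite scalerA mulVf ?sgn_neq0// scale1r.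
Qed.

Lemma submodule_sum U (I : eqType) (s : seq I) (c : I -> K) (f : I -> func) :
  submodule Phi H U -> (forall i, i \in s -> U (f i)) ->
  U (\sum_(i <- s) c i *: f i).
Proof.
move=> sU Uf; rewrite big_seq; apply: big_ind => [|g h|i /Uf].
- exact: (submodule0 sU).
- exact: (submoduleD sU).
- exact: (submoduleZ sU).
Qed.

End Tabloids.

Theorem theorem4p18 (R : realType) (n : nat) (Phi pi : set 'cV[R]_n)
    (K : fieldType) (H H' : set 'M[R]_n) (U : set (set 'M[R]_n -> K^o)) :
  root_system Phi -> simple_system Phi pi ->
  SW_subgroup Phi pi H -> good_dual K Phi pi H H' ->
  submodule Phi H U ->
  (specht Phi pi H H' `<=` U)%classic \/
  (U `<=` orthogonal_complement Phi H (specht Phi pi H H'))%classic.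
Proof.
move=> rootPhi simple_pi _ good sU.
have [sH' H'W] := SW_subgroup_weyl rootPhi (proj1 (proj1 good)).
have [s [_ sE kE]] := kappaE K pi rootPhi H'W.
have [[u [Uu ku]]|no] := pselect (exists u, U u /\ kappa pi H' u <> 0).
  left; have Ue : U (polytabloid K pi H H').
    have [c kc] := kappa_line rootPhi simple_pi sH' H'W good (submodule_sub sU Uu).
    have c0 : c != 0 by apply/eqP => c0; apply: ku; rewrite kc c0 scale0r.
    (* The polytabloid is recovered as the inverse of [c] times the symmetrization of [u], which
       lies in [U] because [H'] lies in the Weyl group. *)
    rewrite -[polytabloid _ _ _ _]scale1r -(mulVf c0) -scalerA -kc.
    apply: (submoduleZ sU); rewrite kE; apply: (submodule_sum _ sU) => w ws.
    by apply: (submodule_act sU) => //; apply: H'W; rewrite sE.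
  move=> _ [t [tS ->]]; apply: (submodule_sum _ sU) => p /tS[w Ww <-].
  exact: (submodule_act sU).
right=> u Uu; split; first exact: (submodule_sub sU).
move=> _ [t [tS ->]]; rewrite form_sumr// big_seq big1// => p /tS[w Ww <-].
rewrite (form_act_polytabloid _ rootPhi simple_pi sH' H'W)//.
suff -> : kappa pi H' (act (invmx w) u) = 0 by rewrite mulr0.
(* The translate of [u] stays in [U], so a nonzero symmetrization would fall under the case already
   excluded. *)
apply: contrapT => k0; apply: no; exists (act (invmx w) u); split=> //.
apply: (submodule_act sU) => //.
exact: (subgroupV (subgroup_weyl rootPhi)).
Qed.
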